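(* Let $\mathcal G$ be a $1$-step solvable $\mathrm{MD}_{n-2}(n)$-algebra with $n=\dim\mathcal G\geq 6$ and $\dim\mathcal G^1\geq 3$. Then $n=6$ and $\mathcal G$ is isomorphic to one of the following real Lie algebras, each given on a basis $\{x_1,\dots,x_6\}$ (all brackets of basis vectors not listed, and not obtained from listed ones by antisymmetry, are zero; in particular $[x_1,x_2]=0$ and $\langle x_3,x_4,x_5,x_6\rangle$ is a commutative ideal): \begin{enumerate} \item $\mathfrak{s}_{6,211}$: $[x_1,x_3]=x_3$, $[x_1,x_4]=x_4$, $[x_1,x_5]=x_5+x_3$, $[x_1,x_6]=x_6+x_4$, $[x_2,x_3]=-x_4$, $[x_2,x_4]=x_3$, $[x_2,x_5]=-x_6$, $[x_2,x_6]=x_5$. \item $\mathfrak{s}_{6,225}(\nu,\theta)$ with $\nu\geq 0$, $\theta\in\mathbb R$: $[x_1,x_3]=x_3$, $[x_1,x_4]=x_4$, $[x_1,x_5]=x_5+\nu x_3-\theta x_4$, $[x_1,x_6]=x_6+\theta x_3+\nu x_4$, $[x_2,x_3]=-x_4$, $[x_2,x_4]=x_3$, $[x_2,x_5]=-x_6+x_3$, $[x_2,x_6]=x_5$. \item $\mathfrak{s}_{6,226}(\lambda,\mu,\zeta)$ with $\lambda\neq 0$, $\mu\geq 0$, $0<\zeta\leq 1$, and $|\lambda|\leq 1$ if $\zeta=1$: $[x_1,x_3]=\lambda x_3$, $[x_1,x_4]=\lambda x_4$, $[x_1,x_5]=x_5$, $[x_1,x_6]=x_6$, $[x_2,x_3]=\mu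 x_3-\zeta x_4$, $[x_2,x_4]=\zeta x_3+\mu x_4$, $[x_2,x_5]=-x_6$, $[x_2,x_6]=x_5$. \item $\mathfrak{s}_{6,228}(\lambda,\mu,\eta,\zeta)$ with $\lambda\zeta-\mu\eta>0$, $\mu\geq 0$: $[x_1,x_3]=\lambda x_3-\eta x_4$, $[x_1,x_4]=\eta x_3+\lambda x_4$, $[x_1,x_5]=x_5$, $[x_1,x_6]=x_6$, $[x_2,x_3]=\mu x_3-\zeta x_4$, $[x_2,x_4]=\zeta x_3+\mu x_4$, $[x_2,x_5]=-x_6$, $[x_2,x_6]=x_5$. \end{enumerate}
   Context: All Lie algebras are finite-dimensional over $\mathbb R$. For a Lie algebra $\mathcal G$, $\mathcal G^0=\mathcal G$, $\mathcal G^{i}=[\mathcal G^{i-1},\mathcal G^{i-1}]$. $\mathcal G$ is called $i$-step solvable if $\mathcal G^i$ is commutative and nonzero (so $1$-step solvable means $\mathcal G^1=[\mathcal G,\mathcal G]$ is commutative and nonzero). For the connected simply connected Lie group $G$ of $\mathcal G$, the coadjoint orbit $\Omega_F$ of $F\in\mathcal G^*$ has dimension $\operatorname{rank}\bigl(F([x_i,x_j])\bigr)_{n\times n}$ for any basis $\{x_1,\dots,x_n\}$ of $\mathcal G$; it is non-trivial (positive-dimensional) iff $F|_{\mathcal G^1}\neq 0$. An $\mathrm{MD}_k(n)$-algebra is an $n$-dimensional real solvable Lie algebra all of whose non-trivial coadjoint orbits have dimension $k$; equivalently, $\operatorname{rank}\bigl(F([x_i,x_j])\bigr)=k$ for every $F\in\mathcal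 G^*$ with $F|_{\mathcal G^1}\neq0$. *)

(* Defs.v *)
(* Real Lie algebras of dimension n are represented on the
   coordinate space 'rV[R]_n (R : realType, i.e. the reals) by a bracket. *)
From HB Require Import structures.
From mathcomp Require Import all_boot all_order all_algebra.
From mathcomp Require Import reals.
Set Implicit Arguments.
Unset Strict Implicit.
Unset Printing Implicit Defensive.
Import Order.TTheory GRing.Theory Num.Theory.
Local Open Scope ring_scope.

Section LieDefs.
Variable R : realType.

Definition is_lie_bracket (n : nat) (br : 'rV[R]_n -> 'rV[R]_n -> 'rV[R]_n) :=
  [/\ (forall a u v w, br (a *: u + v) w = a *: br u w + br v w),
      (forall a u v w, br w (a *: u + v) = a *: br w u + br w v),
      (forall u, br u u = 0) &
      (forall u v w, br u (br v w) + br v (br w u) + br w (br u v) = 0)].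

(* [S, S] for a subspace S given as the row space of a square matrix *)
Definition derivedS (n : nat) (br : 'rV[R]_n -> 'rV[R]_n -> 'rV[R]_n)
  (S : 'M[R]_n) : 'M[R]_n :=
  (\sum_(i < n) \sum_(j < n) <<br (row i S) (row j S)>>)%MS.

Fixpoint derived_series (n : nat) (br : 'rV[R]_n -> 'rV[R]_n -> 'rV[R]_n)
  (i : nat) : 'M[R]_n :=
  match i with
  | 0 => 1%:M
  | i'.+1 => derivedS br (derived_series br i')
  end.

Definition solvable_lie n (br : 'rV[R]_n -> 'rV[R]_n -> 'rV[R]_n) :=
  exists i, derived_series br i = 0.

Definition step_solvable n (br : 'rV[R]_n -> 'rV[R]_n -> 'rV[R]_n) (i : nat) :=
  derivedS br (derived_series br i) = 0 /\ derived_series br i != 0.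

(* a functional F in G^* is a column vector: F(x) = (x *m F) 0 0 *)
Definition coadj_matrix n (br : 'rV[R]_n -> 'rV[R]_n -> 'rV[R]_n)
  (F : 'cV[R]_n) : 'M[R]_n :=
  \matrix_(i < n, j < n) (br (delta_mx 0 i) (delta_mx 0 j) *m F) 0 0.

(* MD_k(n): solvable, every nontrivial coadjoint orbit has dimension k *)
Definition MD_algebra n (br : 'rV[R]_n -> 'rV[R]_n -> 'rV[R]_n) (k : nat) :=
  solvable_lie br /\
  forall F : 'cV[R]_n, derived_series br 1 *m F != 0 ->
    \rank (coadj_matrix br F) = k.

Definition lie_isomorphic n m (br1 : 'rV[R]_n -> 'rV[R]_n -> 'rV[R]_n)
  (br2 : 'rV[R]_m -> 'rV[R]_m -> 'rV[R]_m) :=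
  exists f : 'rV[R]_n -> 'rV[R]_m,
    [/\ (forall a u v, f (a *: u + v) = a *: f u + f v),
        bijective f &
        (forall u v, f (br1 u v) = br2 (f u) (f v))].

(* basis vector x_k of R^6, 1-based as in the paper (k = 1..6) *)
Definition X (k : nat) : 'rV[R]_6 := delta_mx 0 (inord k.-1).

Definition sc6 (a b : nat -> 'rV[R]_6) (i j : 'I_6) : 'rV[R]_6 :=
  let i' := (val i).+1 in let j' := (val j).+1 in
  if (i' == 1%N) && (3 <= j')%N then a j'
  else if (i' == 2%N) && (3 <= j')%N then b j'
  else if (j' == 1%N) && (3 <= i')%N then - a i'
  else if (j' == 2%N) && (3 <= i')%N then - b i'
  else 0.

Definition br6 (a b : nat -> 'rV[R]_6) (u v : 'rV[R]_6) : 'rV[R]_6 :=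
  \sum_(i < 6) \sum_(j < 6) (u 0 i * v 0 j) *: sc6 a b i j.

Definition s6_211 : 'rV[R]_6 -> 'rV[R]_6 -> 'rV[R]_6 :=
  br6 (fun k => match k with
                | 3 => X 3 | 4 => X 4 | 5 => X 5 + X 3 | 6 => X 6 + X 4
                | _ => 0 end)
      (fun k => match k with
                | 3 => - X 4 | 4 => X 3 | 5 => - X 6 | 6 => X 5
                | _ => 0 end).

Definition s6_225 (nu theta : R) : 'rV[R]_6 -> 'rV[R]_6 -> 'rV[R]_6 :=
  br6 (fun k => match k with
                | 3 => X 3 | 4 => X 4
                | 5 => X 5 + nu *: X 3 - theta *: X 4
                | 6 => X 6 + theta *: X 3 + nu *: X 4
                | _ => 0 end)
      (fun k => match k with
                | 3 => - X 4 | 4 => X 3 | 5 => - X 6 + X 3 | 6 => X 5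
                | _ => 0 end).

Definition s6_226 (lambda mu zeta : R) : 'rV[R]_6 -> 'rV[R]_6 -> 'rV[R]_6 :=
  br6 (fun k => match k with
                | 3 => lambda *: X 3 | 4 => lambda *: X 4
                | 5 => X 5 | 6 => X 6
                | _ => 0 end)
      (fun k => match k with
                | 3 => mu *: X 3 - zeta *: X 4
                | 4 => zeta *: X 3 + mu *: X 4
                | 5 => - X 6 | 6 => X 5
                | _ => 0 end).

Definition s6_228 (lambda mu eta zeta : R) : 'rV[R]_6 -> 'rV[R]_6 -> 'rV[R]_6 :=
  br6 (fun k => match k with
                | 3 => lambda *: X 3 - eta *: X 4
                | 4 => eta *: X 3 + lambda *: X 4
                | 5 => X 5 | 6 => X 6
                | _ => 0 end)
      (fun k => match k with
                | 3 => mu *: X 3 - zeta *: X 4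
                | 4 => zeta *: X 3 + mu *: X 4
                | 5 => - X 6 | 6 => X 5
                | _ => 0 end).

End LieDefs.

(* Main.v *)
(* Let A = [G, G]. Since A is abelian, the operators ad x act on A by commuting
   maps, so over the complex numbers they have a common dual eigenvector f,
   f([x, a]) = alpha(x) f(a). The Jacobi identity then makes the form
   f([x, y]) equal to alpha(x) psi(y) - alpha(y) psi(x), so the coadjoint form
   of Re f has rank at most twice the real rank of alpha, hence at most 4. This
   forces n = 6, and alpha : R^n -> C to be onto with kernel containing A.
   The same holds for every common eigenvector, so no weight is real; with
   dim A >= 3 the quotient of A^* by f and its conjugate provides a second
   (possibly generalized) eigenvector h, and dim A = 4. Normalizing
   alpha(x1) = 1, alpha(x2) = i, the real and imaginary parts of f and h are
   the dual basis of the normal forms: s_{6,228} when h is an eigenvector (this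
   includes all of s_{6,226}), otherwise s_{6,211} or s_{6,225}. The signs are
   fixed by complex conjugation together with x2 := - x2. *)
Require Import Defs.
From HB Require Import structures.
From mathcomp Require Import all_boot all_order all_algebra.
From mathcomp Require Import reals.
From mathcomp Require Import complex ring lra zify.
Import Order.TTheory GRing.Theory Num.Theory.
Local Open Scope ring_scope.
Set Implicit Arguments.
Unset Strict Implicit.
Unset Printing Implicit Defensive.

(** * Commuting operators and complex eigenvectors *)

(** The [T i] induce commuting operators on the quotient by the row space of [F], which is nonzero
    by the rank hypothesis. Over an algebraically closed field these have a common eigenvector, and
    [k] is a lift of it. *)
Lemma common_eigenvector_mod (C : numClosedFieldType) (I : finType) (m p : nat)
    (T : I -> 'M[C]_m) (F : 'M[C]_(p, m)) :
  (forall i j, T i *m T j = T j *m T i) ->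
  (forall i, stablemx F (T i)) -> (\rank F < m)%N ->
  exists (k : 'rV[C]_m) (b : I -> C), ~~ (k <= F)%MS /\
    forall i, (k *m T i - b i *: k <= F)%MS.
Proof.
move=> comT stabF rkF.
(* [E] is the quotient map with kernel [F], and [E'] below is a section of it. *)
have [E Efull subE] : exists2 E : 'M_(m, \rank (cokermx F)), row_full E &
    forall q (v : 'M_(q, m)), (v <= F)%MS = (v *m E == 0).
  exists (col_base (cokermx F)); first exact: col_base_full.
  move=> q v; rewrite submxE -{1}(mulmx_base (cokermx F)) mulmxA.
  by rewrite mulmx_free_eq0 ?row_base_free.
have /row_fullP[E' E'E] := Efull.
(* The projection [1 - E E'] has its image in [F], which [T i] preserves and [E] kills. *)
have EM i : E *m (E' *m (T i *m E)) = T i *m E.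
  have: ((1%:M - E *m E') *m T i <= F)%MS.
    apply: submx_trans (stabF i); apply: submxMr.
    by rewrite subE mulmxBl mul1mx -mulmxA E'E mulmx1 subrr.
  rewrite subE !mulmxBl mul1mx subr_eq0 => /eqP.
  by rewrite !mulmxA.
pose S i := E' *m T i *m E.
have comS i j : S i *m S j = S j *m S i.
  rewrite /S -!mulmxA !EM; congr (_ *m _).
  by rewrite !mulmxA comT.
have rk_gt0 : (0 < \rank (cokermx F))%N by rewrite mxrank_coker subn_gt0.
have [|w w0 /allP wS] := common_eigenvector (As := codom S) rk_gt0.
  by move=> _ _ /codomP[i ->] /codomP[j ->]; apply: comS.
have /fin_all_exists[b wb] i : exists b, w *m S i = b *: w.
  by apply/sub_rVP/wS/codom_f.
exists (w *m E'), b; split; first by rewrite subE -mulmxA E'E mulmx1.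
move=> i; rewrite subE mulmxBl -scalemxAl -(mulmxA w E' E) E'E mulmx1.
by rewrite -wb /S !mulmxA subrr.
Qed.

Lemma sub_adds_rVP (K : fieldType) (m : nat) (v f g : 'rV[K]_m) :
  reflect (exists a b, v = a *: f + b *: g) (v <= f + g)%MS.
Proof.
apply: (iffP sub_addsmxP) => [[[u w] /= ->]|[a [b ->]]].
  exists (u 0 0), (w 0 0).
  by rewrite [u]mx11_scalar [w]mx11_scalar !mxE !mul_scalar_mx.
by exists (a%:M, b%:M) => /=; rewrite !mul_scalar_mx.
Qed.

(** Comparing the coefficients of [f] in [k T_i T_j = k T_j T_i] shows that [a] is proportional to
    [b - al]. The factor of proportionality, read off at the index [i], is the shift [c]. *)
Lemma clear_component (K : fieldType) (I : Type) (m : nat) (T : I -> 'M[K]_m)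
    (f g k : 'rV[K]_m) (al al' b a a' : I -> K) (i : I) :
  (forall i j, T i *m T j = T j *m T i) ->
  (forall c d, c *: f + d *: g = 0 -> c = 0) ->
  (forall j, f *m T j = al j *: f) -> (forall j, g *m T j = al' j *: g) ->
  (forall j, k *m T j = b j *: k + a j *: f + a' j *: g) ->
  b i != al i ->
  exists c, forall j, (k + c *: f) *m T j = b j *: (k + c *: f) + a' j *: g.
Proof.
move=> comT fg fT gT kT neq.
exists (a i / (b i - al i)) => j.
have aij : a j * (b i - al i) = a i * (b j - al j).
  apply/eqP; rewrite -subr_eq0; apply/eqP.
  have := congr1 (mulmx k) (comT i j).
  rewrite !mulmxA !kT !mulmxDl -!scalemxAl !kT !fT !gT => /eqP.
  rewrite -subr_eq0 => /eqP e.
  apply: (fg _ (a' j * (b i - al' i) - a' i * (b j - al' j))).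
  rewrite -e; apply/rowP => s; rewrite !mxE; ring.
have nz : b i - al i != 0 by rewrite subr_eq0.
have {}aij : a j = a i / (b i - al i) * (b j - al j).
  by apply: (mulIf nz); rewrite aij mulrAC divfK.
rewrite mulmxDl -scalemxAl kT fT aij.
by apply/rowP => s; rewrite !mxE; ring.
Qed.

(** Modulo the span of [f] and [g], the vectors [h] and [h'] are eigenvectors of [T] with distinct
    eigenvalues. Applying [T - be] to a relation leaves only the multiple [c' (be' - be)] of [h']
    modulo that span. *)
Lemma four_independent (K : fieldType) (m : nat) (f g h h' : 'rV[K]_m)
    (T : 'M[K]_m) (al al' be be' a a' : K) :
  (forall c d, c *: f + d *: g = 0 -> c = 0 /\ d = 0) ->
  ~~ (h <= f + g)%MS -> ~~ (h' <= f + g)%MS ->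
  f *m T = al *: f -> g *m T = al' *: g ->
  h *m T = be *: h + a *: f -> h' *m T = be' *: h' + a' *: g -> be' != be ->
  forall c c' d d', c *: h + c' *: h' + d *: f + d' *: g = 0 ->
    [/\ c = 0, c' = 0, d = 0 & d' = 0].
Proof.
move=> indep hF h'F fT gT hT h'T neq c c' d d' e0.
have c'0 : c' = 0.
  apply/eqP; apply: contraNT h'F => c'_neq0.
  apply/sub_adds_rVP.
  have := congr1 (mulmx^~ T) e0.
  rewrite /= !mulmxDl -!scalemxAl hT h'T fT gT mul0mx.
  have nz : c' * (be' - be) != 0 by rewrite mulf_neq0 // subr_eq0.
  move=> e1; exists (- (c' * (be' - be))^-1 * (c * a + d * (al - be))).
  exists (- (c' * (be' - be))^-1 * (c' * a' + d' * (al' - be))).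
  apply: (scalerI nz); rewrite scalerDr !scalerA !mulrA !mulrN !divff //.
  apply/rowP => s; move/rowP/(_ s): e0; move/rowP/(_ s): e1; rewrite !mxE.
  move=> e1 e0; apply/eqP; rewrite -subr_eq0 -{}e1; apply/eqP.
  by rewrite -[RHS]subr0 -(mulr0 be) -{}e0; ring.
have c0 : c = 0.
  apply/eqP; apply: contraNT hF => c_neq0.
  apply/sub_adds_rVP; exists (- c^-1 * d), (- c^-1 * d').
  apply: (scalerI c_neq0); rewrite scalerDr !scalerA !mulrA !mulrN !divff //.
  move/eqP: e0; rewrite c'0 scale0r addr0 -addrA addr_eq0 => /eqP->.
  by rewrite !mulN1r !scaleNr opprD.
by move: e0; rewrite c0 c'0 !scale0r !add0r => /indep[-> ->].
Qed.

(** * Complex conjugation, real and imaginary parts of row vectors *)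

Section Conjugation.
Variables (R : realType) (m : nat).
Local Open Scope complex_scope.
Implicit Types (f h : 'rV[R[i]]_m) (t : 'M[R]_m).

Definition conjm f : 'rV[R[i]]_m := map_mx (@conjc R) f.
Definition cplxm t : 'M[R[i]]_m := map_mx (real_complex R) t.

Lemma conjmK f : conjm (conjm f) = f.
Proof. by apply/rowP => j; rewrite !mxE conjcK. Qed.

Lemma conjmD f h : conjm (f + h) = conjm f + conjm h.
Proof. exact: map_mxD. Qed.

Lemma conjmZ c f : conjm (c *: f) = (conjc c) *: conjm f.
Proof. exact: map_mxZ. Qed.

Lemma conjmM f t : conjm (f *m cplxm t) = conjm f *m cplxm t.
Proof.
rewrite /conjm map_mxM; congr (_ *m _).
by apply/matrixP=> i j; rewrite !mxE; apply: conjc_real.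
Qed.

(* A common eigenvector modulo [f] and [conjm f]; its components along either
   of them can be cleared unless the corresponding weights coincide. *)
Lemma second_eigenvector (I : finType) (t : I -> 'M[R]_m) (f : 'rV[R[i]]_m)
    (al : I -> R[i]) :
  (2 < m)%N -> (forall i j, t i *m t j = t j *m t i) ->
  (forall c d, c *: f + d *: conjm f = 0 -> c = 0 /\ d = 0) ->
  (forall i, f *m cplxm (t i) = al i *: f) -> (exists i, conjc (al i) != al i) ->
  exists (h : 'rV[R[i]]_m) (be a : I -> R[i]),
    [/\ ~~ (h <= f + conjm f)%MS,
        forall i, h *m cplxm (t i) = be i *: h + a i *: f &
        (forall i, a i = 0) \/ (forall i, be i = al i)].
Proof.
move=> m_gt2 comt indep fT [i0 al_i0].
have comT i j : cplxm (t i) *m cplxm (t j) = cplxm (t j) *m cplxm (t i).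
  by rewrite -!map_mxM comt.
have gT i : conjm f *m cplxm (t i) = conjc (al i) *: conjm f.
  by rewrite -conjmM fT conjmZ.
have indl c d : c *: f + d *: conjm f = 0 -> c = 0 by case/indep.
have indr c d : c *: conjm f + d *: f = 0 -> c = 0.
  by rewrite addrC => /indep[].
have [||k [b [kF kT]]] := common_eigenvector_mod (F := (f + conjm f)%MS) comT.
- move=> i; apply: stableDmx; apply/sub_rVP.
    by exists (al i).
  by exists (conjc (al i)).
- apply: leq_trans m_gt2; rewrite ltnS.
  apply: leq_trans (mxrank_adds_leqif _ _) _.
  by rewrite (leq_add (rank_leq_row _) (rank_leq_row _)).
have {kT} /fin_all_exists[a /fin_all_exists[a' kT]] i :
    exists a a', k *m cplxm (t i) = b i *: k + a *: f + a' *: conjm f.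
  have /sub_adds_rVP[a [a' e]] := kT i.
  by exists a, a'; rewrite -addrA -e addrC subrK.
have notF (k' u : 'rV_m) : ~~ (k' <= f + conjm f)%MS -> (u <= f + conjm f)%MS ->
    ~~ ((k' + u)%R <= f + conjm f)%MS.
  move=> k'F uF; apply: contra k'F => k'uF.
  by rewrite -[k'](addrK u) addmx_sub // eqmx_opp.
have fF c : (c *: f <= f + conjm f)%MS.
  by rewrite scalemx_sub // addsmxSl.
have gF c : (c *: conjm f <= f + conjm f)%MS.
  by rewrite scalemx_sub // addsmxSr.
(* If [b] equals [al], it differs from the conjugate weight at [i0], so the component along
   [conjm f] can be removed. Otherwise the component along [f] can. *)
have [i /= b_i|b_al] := pickP [pred i | b i != al i]; last first.
  have b_i0 : b i0 != conjc (al i0).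
    by have /negbFE/eqP-> := b_al i0; rewrite eq_sym.
  have kT' j : k *m cplxm (t j) = b j *: k + a' j *: conjm f + a j *: f.
    by rewrite kT addrAC.
  have [c kcT] := clear_component comT indr gT fT kT' b_i0.
  exists (k + c *: conjm f), b, a; split=> //; first exact: notF.
  by right=> j; apply/eqP/negbFE/b_al.
have [c kcT] := clear_component comT indl fT gT kT b_i.
have kcF := notF _ _ kF (fF c); set k' := k + c *: f in kcT kcF.
(* If [b] is the conjugate of [al], then [conjm k'] has weight [al] and its remaining component lies
   along [f]. Otherwise the second component is removed as well. *)
have [i' /= b_i'|b_al] := pickP [pred i | b i != conjc (al i)]; last first.
  exists (conjm k'), al, (fun i => conjc (a' i)); split; last by right.
    apply: contra kcF => /sub_adds_rVP[x [y e]].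
    apply/sub_adds_rVP; exists (conjc y), (conjc x).
    by rewrite -[k']conjmK e conjmD !conjmZ conjmK addrC.
  move=> j; rewrite -conjmM kcT conjmD !conjmZ conjmK.
  by have /negbFE/eqP-> := b_al j; rewrite conjcK.
have kcT' j : k' *m cplxm (t j) = b j *: k' + a' j *: conjm f + 0 *: f.
  by rewrite kcT scale0r addr0.
have [c' kc'T] := clear_component comT indr gT fT kcT' b_i'.
exists (k' + c' *: conjm f), b, (fun=> 0); split=> //; first exact: notF.
by left.
Qed.

Definition re_mx f : 'rV[R]_m := map_mx (@complex.Re R) f.
Definition im_mx f : 'rV[R]_m := map_mx (@complex.Im R) f.

Lemma re_mx_mul f t : re_mx (f *m cplxm t) = re_mx f *m t.
Proof.
apply/rowP => j; rewrite !mxE.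
rewrite (big_morph (@complex.Re R) (id1 := 0) (op1 := +%R)) //; last by case=> ? ? [].
by apply: eq_bigr => i _; rewrite !mxE; case: (f 0 i) => a b /=; rewrite mulr0 subr0.
Qed.

Lemma im_mx_mul f t : im_mx (f *m cplxm t) = im_mx f *m t.
Proof.
apply/rowP => j; rewrite !mxE.
rewrite (big_morph (@complex.Im R) (id1 := 0) (op1 := +%R)) //; last by case=> ? ? [].
by apply: eq_bigr => i _; rewrite !mxE; case: (f 0 i) => a b /=; rewrite mulr0 add0r.
Qed.

Lemma re_mxD f h : re_mx (f + h) = re_mx f + re_mx h.
Proof. by apply/rowP => j; rewrite !mxE; case: (f 0 j) (h 0 j) => ? ? []. Qed.

Lemma im_mxD f h : im_mx (f + h) = im_mx f + im_mx h.
Proof. by apply/rowP => j; rewrite !mxE; case: (f 0 j) (h 0 j) => ? ? []. Qed.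

Lemma re_mxZ c f : re_mx (c *: f) = complex.Re c *: re_mx f - complex.Im c *: im_mx f.
Proof. by apply/rowP => j; rewrite !mxE; case: (f 0 j) c => ? ? []. Qed.

Lemma im_mxZ c f : im_mx (c *: f) = complex.Re c *: im_mx f + complex.Im c *: re_mx f.
Proof. by apply/rowP => j; rewrite !mxE; case: (f 0 j) c => ? ? []. Qed.

Lemma re_im_mx_eq0 f : re_mx f = 0 -> im_mx f = 0 -> f = 0.
Proof.
move=> /rowP re0 /rowP im0; apply/rowP => j; move: (re0 j) (im0 j).
by rewrite !mxE; case: (f 0 j) => a b /= -> ->.
Qed.

Definition indep4 f h : Prop := forall c c' d d',
  c *: h + c' *: conjm h + d *: f + d' *: conjm f = 0 ->
  [/\ c = 0, c' = 0, d = 0 & d' = 0].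

(** Conjugating the relation for [h] gives one for [conjm h] with the eigenvalue [conjc be], which
    differs from [be]. *)
Lemma eigenvectors_indep4 f h t (be a al : R[i]) :
  (forall c d, c *: f + d *: conjm f = 0 -> c = 0 /\ d = 0) ->
  ~~ (h <= f + conjm f)%MS -> f *m cplxm t = al *: f ->
  h *m cplxm t = be *: h + a *: f -> conjc be != be -> indep4 f h.
Proof.
move=> indep hF fT hT be_im.
have gT : conjm f *m cplxm t = conjc al *: conjm f by rewrite -conjmM fT conjmZ.
have conjhF : ~~ (conjm h <= f + conjm f)%MS.
  apply: contra hF => /sub_adds_rVP[x [y e]].
  apply/sub_adds_rVP; exists (conjc y), (conjc x).
  by rewrite -[h]conjmK e conjmD !conjmZ conjmK addrC.
have h'T : conjm h *m cplxm t = conjc be *: conjm h + conjc a *: conjm f.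
  by rewrite -conjmM hT conjmD !conjmZ.
exact: four_independent indep hF conjhF fT gT hT h'T be_im.
Qed.

(** This and the next three lemmas are the changes of eigenvectors used to normalize parameters:
    each permutes the four vectors or changes them by an invertible triangular matrix. *)
Lemma indep4_conjl f h : indep4 f h -> indep4 f (conjm h).
Proof.
by move=> fh c c' d d'; rewrite conjmK (addrC (c *: _)) => /fh[-> -> -> ->].
Qed.

Lemma indep4_conj f h : indep4 f h -> indep4 (conjm f) (conjm h).
Proof.
move=> fh c c' d d'; rewrite !conjmK (addrC (c *: _)) -addrA (addrC (d *: _)) addrA.
by move=> /fh[-> -> -> ->].
Qed.

Lemma indep4_scale f h x : x != 0 -> indep4 f h -> indep4 (x *: f) h.
Proof.
move=> x0 fh c c' d d'; rewrite conjmZ !scalerA => /fh[-> -> /eqP + /eqP].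
rewrite !mulf_eq0 conjc_eq0 (negPf x0) !orbF.
by move=> /eqP-> /eqP->.
Qed.

Lemma indep4_shift f h x : indep4 f h -> indep4 f (h + x *: conjm f).
Proof.
move=> fh c c' d d' e.
have /fh[c0 c'0 + +] : c *: h + c' *: conjm h + (d + c' * conjc x) *: f +
    (d' + c * x) *: conjm f = 0.
  rewrite -{}e conjmD conjmZ conjmK; move: (conjm h) (conjm f) => h' f'.
  by apply/rowP => j; rewrite !mxE; ring.
by rewrite c0 c'0 !mul0r !addr0 => -> ->.
Qed.

(** Twice a real relation with coefficients [w0], [w1] on the imaginary and real parts of [h] is the
    complex relation with coefficients [w1 - i w0] on [h] and [w1 + i w0] on [conjm h]; likewise for
    [f]. *)
Lemma row_free_re_im f h : indep4 f h ->
  row_free (col_mx (col_mx (im_mx h) (re_mx h)) (col_mx (im_mx f) (re_mx f))).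
Proof.
move=> fh.
apply: inj_row_free => v; rewrite -[v]hsubmxK.
set v1 := lsubmx v; set v2 := rsubmx v.
rewrite -[v1]hsubmxK -[v2]hsubmxK !mul_row_col.
set w0 := lsubmx v1; set w1 := rsubmx v1.
set w2 := lsubmx v2; set w3 := rsubmx v2.
rewrite [w0]mx11_scalar [w1]mx11_scalar [w2]mx11_scalar [w3]mx11_scalar.
rewrite !mul_scalar_mx => e.
have /fh : (w1 0 0 -i* w0 0 0) *: h + (w1 0 0 +i* w0 0 0) *: conjm h +
    (w3 0 0 -i* w2 0 0) *: f + (w3 0 0 +i* w2 0 0) *: conjm f = 0.
  apply/rowP => s; move/rowP/(_ s): e; rewrite !mxE.
  case: (h 0 s) => hr hi; case: (f 0 s) => fr fi /= e.
  apply/eqP; rewrite eq_complex /=.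
  by apply/andP; split; apply/eqP; [lra|ring].
case=> _ [-> ->] _ [-> ->].
by rewrite !raddf0 !row_mx0.
Qed.

End Conjugation.

(** * Weights of the action on the derived algebra *)

Section WeightMatrix.
Local Open Scope complex_scope.
Variables (R : realType) (n : nat) (al : 'rV[R]_n -> R[i]).

(** For a real linear [al], this is its matrix as a map to the real plane, so the rank is the real
    rank of the weight. *)
Definition weight_mx : 'M[R]_(n, 1 + 1) :=
  row_mx (\col_i complex.Re (al (delta_mx 0 i))) (\col_i complex.Im (al (delta_mx 0 i))).

(** Were all these values real, the second column would vanish and the rank would be at most 1. *)
Lemma weight_nonreal : \rank weight_mx = 2 ->
  exists i, conjc (al (delta_mx 0 i)) != al (delta_mx 0 i).
Proof.
move=> rk2; apply/existsP; apply: contraTT isT => /existsPn al_real.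
have Im0 : (\col_i complex.Im (al (delta_mx 0 i)) : 'cV[R]_n) = 0.
  apply/colP => i; rewrite !mxE; have := al_real i.
  rewrite negbK; case: (al _) => a b /= /eqP[] e.
  by lra.
have := rk2; rewrite /weight_mx Im0 -mxrank_tr tr_row_mx trmx0 => rk.
have := rank_leq_row (\col_i complex.Re (al (delta_mx 0 i)))^T.
have := mxrank_adds_leqif (\col_i complex.Re (al (delta_mx 0 i)))^T (0 : 'M_(1, n)).
move=> [+ _]; rewrite addsmxE rk mxrank0; lia.
Qed.

End WeightMatrix.

(** * The adjoint action on the derived algebra and the rank bound for its weights *)

Section LieAlgebra.
Variables (R : realType) (n : nat) (br : 'rV[R]_n -> 'rV[R]_n -> 'rV[R]_n).
Hypothesis lie : is_lie_bracket br.
Implicit Types u v w x y z : 'rV[R]_n.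

Lemma brPl a u v w : br (a *: u + v) w = a *: br u w + br v w.
Proof. by have [H _ _ _] := lie. Qed.

Lemma brPr a u v w : br w (a *: u + v) = a *: br w u + br w v.
Proof. by have [_ H _ _] := lie. Qed.

Lemma brxx u : br u u = 0.
Proof. by have [_ _ H _] := lie. Qed.

Lemma br_jacobi u v w : br u (br v w) + br v (br w u) + br w (br u v) = 0.
Proof. by have [_ _ _ H] := lie. Qed.

Lemma br0 u : br u 0 = 0.
Proof.
have := brPr 1 0 0 u; rewrite !scale1r addr0 => /eqP.
by rewrite -subr_eq0 opprD addrA subrr sub0r oppr_eq0 => /eqP.
Qed.

Lemma brDl u v w : br (u + v) w = br u w + br v w.
Proof. by have := brPl 1 u v w; rewrite !scale1r. Qed.

Lemma brDr u v w : br w (u + v) = br w u + br w v.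
Proof. by have := brPr 1 u v w; rewrite !scale1r. Qed.

Lemma brZr a u w : br w (a *: u) = a *: br w u.
Proof. by have := brPr a u 0 w; rewrite br0 !addr0. Qed.

Lemma br_anti u v : br u v = - br v u.
Proof.
have := brxx (u + v); rewrite brDl !brDr !brxx add0r addr0 => /eqP.
by rewrite addr_eq0 => /eqP.
Qed.

Lemma br_sumr (I : Type) (r : seq I) (c : I -> R) (e : I -> 'rV[R]_n) w :
  br w (\sum_(i <- r) c i *: e i) = \sum_(i <- r) c i *: br w (e i).
Proof.
elim/big_rec2: _ => [|i y z _ e_yz]; first exact: br0.
by rewrite brPr e_yz.
Qed.

Definition ad x : 'M[R]_n := \matrix_i br x (delta_mx 0 i).

Lemma br_ad x v : br x v = v *m ad x.
Proof.
rewrite {1}[v]row_sum_delta br_sumr mulmx_sum_row.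
by apply: eq_bigr => i _; rewrite rowK.
Qed.

Let d := derived_series br 1.

Lemma br_derived u v : (br u v <= d)%MS.
Proof.
have basis i j : (br (delta_mx 0 i) (delta_mx 0 j) <= d)%MS.
  rewrite /d /= /derivedS (sumsmx_sup i) // (sumsmx_sup j) //.
  by rewrite !row1 genmxE.
rewrite [v]row_sum_delta br_sumr summx_sub // => j _; rewrite scalemx_sub //.
rewrite br_anti eqmx_opp [u]row_sum_delta br_sumr summx_sub // => i _.
by rewrite scalemx_sub // br_anti eqmx_opp.
Qed.

Hypothesis abel : derivedS br d = 0.

Lemma br_abelian u v : (u <= d)%MS -> (v <= d)%MS -> br u v = 0.
Proof.
have rows i j : br (row i d) (row j d) = 0.
  apply/eqP; rewrite -submx0 -abel /derivedS.
  by rewrite (sumsmx_sup i) // (sumsmx_sup j) // genmxE.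
move=> /submxP[a ->] /submxP[b ->].
rewrite [b *m d]mulmx_sum_row br_sumr big1 // => j _.
rewrite br_anti mulmx_sum_row br_sumr big1 ?oppr0 ?scaler0 // => i _.
by rewrite rows scaler0.
Qed.

Variables (m : nat) (D : 'M[R]_(m, n)).
Hypotheses (eqD : (D :=: d)%MS) (freeD : row_free D).

(** The matrix of [ad x] on the derived algebra in the basis formed by the rows of [D]; its
    transpose acts on functionals. The lock keeps it from being unfolded. *)
Definition rho x : 'M[R]_m := locked (D *m ad x *m pinvmx D).

Lemma rhoE x : D *m ad x = rho x *m D.
Proof.
rewrite /rho -lock mulmxKpV // eqD; apply/row_subP => i.
by rewrite row_mul -br_ad br_derived.
Qed.

Lemma br_rho x (v : 'rV[R]_m) : br x (v *m D) = v *m rho x *m D.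
Proof. by rewrite br_ad -mulmxA rhoE mulmxA. Qed.

Lemma rhoP a x y : rho (a *: x + y) = a *: rho x + rho y.
Proof.
apply: (row_free_inj freeD); rewrite /= -rhoE mulmxDl -scalemxAl -!rhoE.
rewrite scalemxAr -mulmxDr; congr (_ *m _).
by apply/row_matrixP => i; rewrite linearD linearZ /= !rowK brPl.
Qed.

Lemma rho_derived x : (x <= d)%MS -> rho x = 0.
Proof.
move=> xd; apply: (row_free_inj freeD); rewrite /= -rhoE mul0mx.
apply/row_matrixP => i; rewrite row_mul -br_ad row0 br_abelian //.
by rewrite -eqD row_sub.
Qed.

(** By the Jacobi identity the commutator is the action of [[x, y]], which lies in the derived
    algebra and hence kills it. *)
Lemma rho_comm x y : rho x *m rho y = rho y *m rho x.
Proof.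
apply: (row_free_inj freeD) => /=; apply/row_matrixP => i.
have rowi a b : row i (rho a *m rho b *m D) = br b (br a (delta_mx 0 i *m D)).
  by rewrite !br_rho rowE -!mulmxA.
rewrite !{}rowi; set v := delta_mx _ _ *m D.
have vd : (v <= d)%MS by rewrite -eqD submxMl.
have := br_jacobi x y v; rewrite (br_abelian vd (br_derived _ _)) addr0.
rewrite (br_anti v x) -scaleN1r brZr scaleN1r => /eqP.
by rewrite subr_eq0 => /eqP->.
Qed.

Local Open Scope complex_scope.

Section Weight.
Variable al : 'rV[R]_n -> R[i].

Variable f : 'rV[R[i]]_m.
Hypothesis f_weight : forall x, f *m cplxm (rho x)^T = al x *: f.

Hypothesis f_neq0 : f != 0.

Lemma weightP a x y : al (a *: x + y) = a%:C * al x + al y.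
Proof.
apply/eqP; rewrite -subr_eq0; apply: contraNT f_neq0 => neq0.
have e : (al (a *: x + y) - (a%:C * al x + al y)) *: f = 0.
  rewrite scalerBl scalerDl -scalerA -!f_weight rhoP.
  rewrite /cplxm linearD linearZ /= map_mxD map_mxZ mulmxDr -scalemxAr.
  by rewrite subrr.
by rewrite -(scalerK neq0 f) e scaler0.
Qed.

Lemma weight_mxE x : x *m weight_mx al =
  row_mx (complex.Re (al x))%:M (complex.Im (al x))%:M.
Proof.
have al0 : al 0 = 0.
  by have := weightP (-1) 0 0; rewrite scaler0 addr0 rmorphN1 mulN1r addNr.
rewrite {1}[x]row_sum_delta mulmx_suml {2 3}[x]row_sum_delta.
elim/big_rec2: _ => [|i u v _ ->].
  by rewrite al0 /= raddf0 row_mx0.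
rewrite weightP -scalemxAl -rowE row_row_mx scale_row_mx add_row_mx.
congr row_mx; apply/rowP => j; rewrite !mxE ord1 !mulr1n;
  by case: (al 'e_i) (al u) => a b [a' b'] /=; ring.
Qed.

Section Coadjoint.
Hypothesis MD : forall F : 'cV[R]_n,
  d *m F != 0 -> \rank (coadj_matrix br F) = (n - 2)%N.
Hypotheses (n_ge6 : (6 <= n)%N) (m_ge3 : (3 <= m)%N).

(* With [F = Re f] and [omega (x, y) = f [x, y]], the Jacobi identity gives
   [omega = al /\ psi], so [F] has rank at most twice the real rank of [al]. *)
Lemma weight_rank_re : re_mx f != 0 -> n = 6 /\ \rank (weight_mx al) = 2.
Proof.
move=> p_neq0; set p := re_mx f in p_neq0; set q := im_mx f.
have pT x : p *m (rho x)^T = complex.Re (al x) *: p - complex.Im (al x) *: q.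
  by rewrite -re_mx_mul f_weight re_mxZ.
have qT x : q *m (rho x)^T = complex.Re (al x) *: q + complex.Im (al x) *: p.
  by rewrite -im_mx_mul f_weight im_mxZ.
(* [om r w] is the value on [w], taken in the derived algebra, of the functional with coordinates
   [r]; [omc x y] is then the complex number [f([x, y])]. *)
pose om (r : 'rV_m) (w : 'rV_n) := (w *m pinvmx D *m r^T) 0 0.
pose omc x y := Complex (om p (br x y)) (om q (br x y)).
have DE : D *m pinvmx D = 1%:M by exact: mulmxVp.
have omDw r u v : om r (u + v) = om r u + om r v.
  by rewrite /om !mulmxDl mxE.
have om0w r : om r 0 = 0 by rewrite /om !mul0mx mxE.
have omD (r s : 'rV_m) a b w : om (a *: r + b *: s) w = a * om r w + b * om s w.
  by rewrite /om linearD !linearZ /= mulmxDr -!scalemxAr mxE !mxE.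
have om_br (r : 'rV_m) x y z : om r (br x (br y z)) = om (r *m (rho x)^T) (br y z).
  rewrite /om trmx_mul trmxK.
  have /submxP[c ->] : (br y z <= D)%MS by rewrite eqD br_derived.
  by rewrite br_rho -!(mulmxA _ D) DE !mulmx1 mulmxA.
have omc_br x y z : omc x (br y z) = al x * omc y z.
  apply/eqP; rewrite eq_complex /= !om_br pT qT -scaleNr !omD.
  by case: (al x) => a b /=; rewrite mulNr !eqxx.
have omc_jacobi x y z :
    al x * omc y z + al y * omc z x + al z * omc x y = 0.
  rewrite -!omc_br; apply/eqP; rewrite eq_complex /=.
  by rewrite -!omDw br_jacobi // !om0w eqxx.
have omc_anti x y : omc x y = - omc y x.
  have omN r : om r (br x y) = - om r (br y x).
    by apply/eqP; rewrite -addr_eq0 -omDw br_anti // addNr om0w.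
  by apply/eqP; rewrite eq_complex /= !omN !eqxx.
(* [F] extends the functional [Re f] to the whole algebra, so its coadjoint matrix is the real part
   of [omc]. *)
pose F := pinvmx D *m p^T.
have dF : d *m F != 0.
  apply: contraNneq p_neq0 => dF0.
  have /submxP[X DX] : (D <= d)%MS by rewrite eqD.
  rewrite -trmx_eq0 (_ : p^T = D *m F); last by rewrite mulmxA DE mul1mx.
  by rewrite {1}DX -mulmxA dF0 mulmx0.
have rkF := MD dF.
have coF i j : coadj_matrix br F i j = complex.Re (omc (delta_mx 0 i) (delta_mx 0 j)).
  by rewrite mxE /F mulmxA.
have rkU2 : (\rank (weight_mx al) <= 2)%N by exact: rank_leq_col.
have [al0|[z alz]] : (forall x, al x = 0) \/ exists z, al z != 0.
- have [z /= alz|al_e] := pickP [pred i : 'I_n | al (delta_mx 0 i) != 0].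
    by right; exists (delta_mx 0 z).
  left => x; have := weight_mxE x; rewrite (_ : (weight_mx al) = 0).
    rewrite mulmx0 -row_mx0 => /eq_row_mx[/rowP/(_ 0) + /rowP/(_ 0)].
    by rewrite !mxE !mulr1n; case: (al x) => a b /= <- <-.
  apply/eqP; rewrite row_mx_eq0; apply/andP.
  by split; apply/eqP/colP => i; rewrite !mxE; have /negbFE/eqP-> := al_e i.
(* If [al] were zero, the derived algebra would lie in the radical of the form of [F]; rank [n - 2]
   would then give [m <= 2]. *)
- have FD : coadj_matrix br F *m D^T = 0.
    apply/row_matrixP => i; rewrite row_mul row0.
    have -> : row i (coadj_matrix br F) = (ad (delta_mx 0 i) *m F)^T.
      apply/rowP => j; rewrite !mxE.
      by apply: eq_bigr => k _; rewrite !mxE.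
    rewrite -trmx_mul mulmxA rhoE -mulmxA (mulmxA D) DE mul1mx.
    rewrite -[rho _]trmxK -trmx_mul pT al0 /= !scale0r subr0.
    by rewrite !trmx0.
  have := mulmx0_rank_max FD; rewrite rkF mxrank_tr (eqP freeD); lia.
(* Dividing the identity [omc_jacobi x y z] by [al z] yields the decomposition with this [psi]. *)
pose psi y := omc z y / al z.
have omc_psi x y : omc x y = al x * psi y - al y * psi x.
  have K (c : R[i]) : al z * (c / al z) = c by rewrite mulrC divfK.
  apply: (mulfI alz); rewrite /psi mulrBr (mulrCA _ (al x)) (mulrCA _ (al y)) !K.
  have := omc_jacobi x y z; rewrite (omc_anti y z) mulrN => jac.
  by apply/eqP; rewrite -subr_eq0 -{}jac; apply/eqP; ring.
(* The sign in the second row comes from [Re (al psi) = Re al Re psi - Im al Im psi]. *)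
pose V : 'M[R]_(1 + 1, n) := col_mx (\row_j complex.Re (psi (delta_mx 0 j)))
                                    (\row_j - complex.Im (psi (delta_mx 0 j))).
have coUV : coadj_matrix br F = weight_mx al *m V - (weight_mx al *m V)^T.
  apply/matrixP => i j; rewrite coF omc_psi mul_row_col !mxE !big_ord1 !mxE.
  case: (al _) (al _) (psi _) (psi _) => a b [a' b'] [c e] [c' e'] /=.
  ring.
(* With [n >= 6] and a rank of at most 2, this forces equality everywhere. *)
have : (n - 2 <= \rank (weight_mx al) + \rank (weight_mx al))%N.
  rewrite -rkF coUV; apply: leq_trans (mxrank_add _ _) _.
  by rewrite mxrank_opp mxrank_tr leq_add // mxrankM_maxl.
lia.
Qed.

End Coadjoint.

Lemma weight_derived : D *m weight_mx al = 0.
Proof.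
apply/row_matrixP => i; rewrite row_mul row0 weight_mxE.
have al0 : al (row i D) = 0.
  have := f_weight (row i D); rewrite rho_derived //; last by rewrite -eqD row_sub.
  rewrite trmx0 /cplxm map_mx0 mulmx0 => /esym/eqP.
  by rewrite scaler_eq0 (negPf f_neq0) orbF => /eqP.
by rewrite al0 /= raddf0 row_mx0.
Qed.

End Weight.

(** The real linear extension of values given on the standard basis: it passes from the finitely
    many operators of the basis vectors to the whole algebra. *)
Definition linC (b : 'I_n -> R[i]) x : R[i] := \sum_i (x 0 i)%:C * b i.

Lemma linC_delta b i : linC b (delta_mx 0 i) = b i.
Proof.
rewrite /linC (bigD1 i) //= big1 => [|j ji]; rewrite mxE eqxx /=.
  by rewrite eqxx mul1r addr0.
by rewrite (negPf ji) mul0r.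
Qed.

Lemma rho_linC (h f : 'rV[R[i]]_m) (b a : 'I_n -> R[i]) :
  (forall i, h *m cplxm (rho (delta_mx 0 i))^T = b i *: h + a i *: f) ->
  forall x, h *m cplxm (rho x)^T = linC b x *: h + linC a x *: f.
Proof.
move=> hT x; have rho0 : rho 0 = 0 by rewrite rho_derived ?sub0mx.
have -> : linC b x *: h + linC a x *: f =
    \sum_i (x 0 i)%:C *: (b i *: h + a i *: f).
  rewrite /linC !scaler_suml -big_split /=; apply: eq_bigr => i _.
  by rewrite scalerDr !scalerA.
rewrite {1}[x]row_sum_delta.
elim/big_rec2: _ => [|i u v _ <-]; first by rewrite rho0 trmx0 /cplxm map_mx0 mulmx0.
rewrite rhoP /cplxm linearD linearZ /= map_mxD map_mxZ mulmxDr -scalemxAr.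
by rewrite -hT.
Qed.

Hypothesis MD : forall F : 'cV[R]_n,
  d *m F != 0 -> \rank (coadj_matrix br F) = (n - 2)%N.
Hypotheses (n_ge6 : (6 <= n)%N) (m_ge3 : (3 <= m)%N).

(** If the real part of [f] vanishes, [i f] has the same weight and the real part [- im_mx f], which
    is nonzero. *)
Lemma weight_rank (al : 'rV[R]_n -> R[i]) (f : 'rV[R[i]]_m) :
  (forall x, f *m cplxm (rho x)^T = al x *: f) -> f != 0 ->
  n = 6 /\ \rank (weight_mx al) = 2.
Proof.
move=> fT f0; have [re0|] := eqVneq (re_mx f) 0; last exact: weight_rank_re.
apply: (weight_rank_re (f := 'i%C *: f)) => //.
- by move=> x; rewrite -scalemxAl fT !scalerA mulrC.
- by rewrite scaler_eq0 negb_or f0 andbT eq_complex /= oner_eq0 andbF.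
rewrite re_mxZ re0 /= scaler0 sub0r scale1r oppr_eq0.
by apply: contraNneq f0 => im0; apply/eqP/re_im_mx_eq0.
Qed.

Lemma first_weight : exists (al : 'rV[R]_n -> R[i]) (f : 'rV[R[i]]_m),
  (forall x, f *m cplxm (rho x)^T = al x *: f) /\ f != 0.
Proof.
pose T (i : 'I_n) := cplxm (rho (delta_mx 0 i))^T.
have [i j|i||f [b [f0 fT]]] :=
    common_eigenvector_mod (T := T) (F := (0 : 'M_m)).
- by rewrite /T /cplxm -!map_mxM -!trmx_mul rho_comm.
- by rewrite mul0mx sub0mx.
- by rewrite mxrank0; lia.
exists (linC b), f; split; last by apply: contraNneq f0 => ->; apply: sub0mx.
move=> x; rewrite (rho_linC (b := b) (a := fun=> 0) (f := 0)) ?scaler0 ?addr0 // => i.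
apply/eqP; rewrite -subr_eq0.
by have := fT i; rewrite submx0 addr0.
Qed.

End LieAlgebra.

(** If the determinant vanished, the product with the adjugate would be zero; invertibility would
    make the adjugate zero, and with it the matrix. *)
Lemma rank_block22 (K : fieldType) (a b c d : K) :
  \rank (block_mx a%:M b%:M c%:M d%:M : 'M_(1 + 1)) = 2 -> a * d - b * c != 0.
Proof.
set A := block_mx _ _ _ _ => rkA; apply/eqP => det0.
have Au : A \in unitmx by rewrite -row_full_unit /row_full rkA.
have : A *m block_mx d%:M (- b)%:M (- c)%:M a%:M = 0.
  rewrite mulmx_block -!scalar_mxM -!raddfD /=.
  have -> : a * d + b * - c = 0 by rewrite -det0; ring.
  have -> : a * - b + b * a = 0 by ring.
  have -> : c * d + d * - c = 0 by ring.
  have -> : c * - b + d * a = 0 by rewrite -det0; ring.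
  by rewrite !raddf0 block_mx0.
move/(congr1 (mulmx (invmx A))); rewrite mulKmx // mulmx0 -block_mx0.
have scal0 (x : K) : (x%:M : 'M_1) = 0 -> x = 0.
  by move/matrixP/(_ 0 0); rewrite !mxE.
move=> /eq_block_mx[/scal0 d0 /scal0/eqP b0 /scal0/eqP c0 /scal0 a0].
move: b0 c0 rkA; rewrite !oppr_eq0 => /eqP b0 /eqP c0.
by rewrite /A a0 b0 c0 d0 !raddf0 block_mx0 mxrank0.
Qed.

(** * Dimensions and a joint eigenbasis of the complexified dual *)

Section Structure.
Local Open Scope complex_scope.
Variables (R : realType) (n : nat) (br : 'rV[R]_n -> 'rV[R]_n -> 'rV[R]_n).
Hypothesis lie : is_lie_bracket br.
Let d := derived_series br 1.
Hypothesis abel : derivedS br d = 0.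
Variables (m : nat) (D : 'M[R]_(m, n)).
Hypotheses (eqD : (D :=: d)%MS) (freeD : row_free D).
Hypothesis MD : forall F : 'cV[R]_n,
  d *m F != 0 -> \rank (coadj_matrix br F) = (n - 2)%N.
Hypotheses (n_ge6 : (6 <= n)%N) (m_ge3 : (3 <= m)%N).

(** The weight of [f] maps onto the complex numbers, which allows choosing [x1] and [x2] with values
    [1] and [i]. As it vanishes on the derived algebra, [x1] and [x2] complete [D] to a basis. *)
Lemma joint_eigenbasis : [/\ n = 6, m = 4 &
  exists (x1 x2 : 'rV[R]_n) (f h : 'rV[R[i]]_m) (b1 b2 a1 a2 : R[i]),
  [/\ row_free (col_mx (col_mx x1 x2) D),
      indep4 f h,
      f *m cplxm (rho br D x1)^T = f /\ f *m cplxm (rho br D x2)^T = 'i%C *: f,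
      h *m cplxm (rho br D x1)^T = b1 *: h + a1 *: f /\
      h *m cplxm (rho br D x2)^T = b2 *: h + a2 *: f &
      [/\ a1 = 0, a2 = 0 &
        complex.Re b1 * complex.Im b2 - complex.Im b1 * complex.Re b2 != 0] \/
      (b1 = 1 /\ b2 = 'i%C)]].
Proof.
have [al [f [fT f0]]] := first_weight lie abel eqD freeD n_ge6 m_ge3.
have [n6 rkW] := weight_rank lie eqD freeD MD n_ge6 m_ge3 fT f0.
have [i0 al_i0] := weight_nonreal rkW.
(* [f] and [conjm f] have distinct eigenvalues at the index [i0]. *)
have indep c e : c *: f + e *: conjm f = 0 -> c = 0 /\ e = 0.
  move=> e0; have gf0 : conjm f != 0.
    by apply: contraNneq f0 => g0; rewrite -[f]conjmK g0 /conjm map_mx0.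
  have e_eq0 : e = 0.
    have := congr1 (mulmx^~ (cplxm (rho br D (delta_mx 0 i0))^T)) e0.
    rewrite /= mulmxDl -!scalemxAl -conjmM fT conjmZ mul0mx => e1.
    set c1 := al _ in al_i0 e1.
    have : (e * (conjc c1 - c1)) *: conjm f = 0.
      transitivity ((c *: (c1 *: f) + e *: (conjc c1 *: conjm f)) -
                    c1 *: (c *: f + e *: conjm f)).
        rewrite mulrBr scalerBl scalerDr !scalerA (mulrC c1 c) (mulrC c1 e).
        by rewrite opprD addrACA subrr add0r.
      by rewrite e1 e0 scaler0 subr0.
    move/eqP; rewrite scaler_eq0 (negPf gf0) orbF mulf_eq0 subr_eq0 (negPf al_i0) orbF.
    by move/eqP.
  split=> //; move/eqP: e0; rewrite e_eq0 scale0r addr0 scaler_eq0 (negPf f0) orbF.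
  by move/eqP.
pose t (i : 'I_n) := (rho br D (delta_mx 0 i))^T.
have comt i j : t i *m t j = t j *m t i.
  by rewrite /t -!trmx_mul (rho_comm lie abel eqD freeD).
have [||h [be [a [hF hT ha]]]] :=
    second_eigenvector (t := t) (al := fun i => al (delta_mx 0 i)) m_ge3 comt indep.
- by move=> i; apply: fT.
- by exists i0.
have hTx := rho_linC lie abel eqD freeD hT.
have h0 : h != 0 by apply: contraNneq hF => ->; apply: sub0mx.
have h_weight : (forall i, a i = 0) ->
    forall x, h *m cplxm (rho br D x)^T = linC be x *: h.
  move=> a0 x; rewrite hTx [linC a x]big1 ?scale0r ?addr0 // => i _.
  by rewrite a0 mulr0.
(* Either [h] is a common eigenvector, and the rank bound applies to its weight too, or it shares
   the nonreal weight [al]. *)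
have [i1 be_i1] : exists i, conjc (be i) != be i.
  case: ha => [a0|be_al]; last by exists i0; rewrite be_al.
  have [_ rkW'] := weight_rank lie eqD freeD MD n_ge6 m_ge3 (h_weight a0) h0.
  by have [j be_j] := weight_nonreal rkW'; exists j; rewrite linC_delta in be_j.
have fh := eigenvectors_indep4 indep hF (fT _) (hT i1) be_i1.
have free4 := row_free_re_im fh.
have m_ge4 : (4 <= m)%N.
  by rewrite -[4%N](eqP free4) rank_leq_col.
have DW := weight_derived lie abel eqD freeD fT f0.
(* The derived algebra lies in the kernel of a map of rank 2 on a space of dimension 6, so
   [m <= 4]. *)
have m4 : m = 4.
  have := mulmx0_rank_max DW; rewrite rkW (eqP freeD); lia.
split=> //.
have fullW : row_full (weight_mx al) by rewrite /row_full rkW.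
have pre c e : exists x, al x = c +i* e.
  have /submxP[x xW] : (row_mx c%:M e%:M <= weight_mx al)%MS by apply: submx_full.
  exists x; move: xW; rewrite (weight_mxE lie eqD freeD fT f0).
  move=> /eq_row_mx[/rowP/(_ 0) + /rowP/(_ 0)]; rewrite !mxE !mulr1n.
  by case: (al x) => ? ? /= -> ->.
have [x1 x1E] := pre 1 0; have [x2 x2E] := pre 0 1.
have weight_xx (al' : _ -> R[i]) (f' : 'rV_m) :
    (forall x, f' *m cplxm (rho br D x)^T = al' x *: f') -> f' != 0 ->
    col_mx (col_mx x1 x2) D *m weight_mx al' = col_mx (block_mx
      (complex.Re (al' x1))%:M (complex.Im (al' x1))%:M
      (complex.Re (al' x2))%:M (complex.Im (al' x2))%:M) 0.
  move=> f'T f'0; rewrite !mul_col_mx !(weight_mxE lie eqD freeD f'T f'0).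
  by rewrite (weight_derived lie abel eqD freeD f'T f'0) block_mxEv.
have free6 : row_free (col_mx (col_mx x1 x2) D).
  apply: inj_row_free => v v0.
  have := congr1 (mulmx^~ (weight_mx al)) v0.
  rewrite -mulmxA (weight_xx _ _ fT f0) x1E x2E /= mul0mx.
  rewrite -[v]hsubmxK mul_row_col mulmx0 addr0.
  rewrite raddf0 -scalar_mx_block mulmx1 => v1_0.
  move: v0; rewrite -[v]hsubmxK mul_row_col v1_0 mul0mx add0r => /eqP.
  by rewrite mulmx_free_eq0 // row_mxKl row_mxKr => /eqP->; rewrite row_mx0.
exists x1, x2, f, h, (linC be x1), (linC be x2), (linC a x1), (linC a x2).
split=> //.
- by split; rewrite fT ?x1E ?x2E ?scale1r.
- case: ha => [a0|be_al]; [left|right].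
  split; try by rewrite [LHS]big1 // => i _; rewrite a0 mulr0.
  (* In the basis [x1], [x2], [D] the weight of [h] is a 2 by 2 block above zeros; its rank is 2, so
     the block is invertible. *)
  have [_ rkW'] := weight_rank lie eqD freeD MD n_ge6 m_ge3 (h_weight a0) h0.
  apply: rank_block22; rewrite -(rank_col_mx0 m) -(weight_xx _ _ (h_weight a0) h0).
  by rewrite eqmxMfull // /row_full (eqP free6) m4 n6.
(* [al], being linear, is the extension of its own values on the standard basis. *)
have be_lin x : linC be x = al x.
  have al_lin (i : 'I_n) :
      f *m cplxm (rho br D (delta_mx 0 i))^T = be i *: f + 0 *: f.
    by rewrite fT be_al scale0r addr0.
  have := rho_linC lie abel eqD freeD al_lin x.
  rewrite fT [linC (fun=> 0) x]big1 ?scale0r ?addr0 => [|i _]; last by rewrite mulr0.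
  by move/eqP; rewrite -subr_eq0 -scalerBl scaler_eq0 (negPf f0) orbF subr_eq0 => /eqP.
by rewrite !be_lin.
Qed.

End Structure.

(** * Normal forms *)

Section NormalForms.
Local Open Scope complex_scope.
Variables (R : realType) (br : 'rV[R]_6 -> 'rV[R]_6 -> 'rV[R]_6).
Hypothesis lie : is_lie_bracket br.

(** The basis [x1], [x2], rows of [y] has the structure constants [sc6 a b], and the isomorphism
    takes coordinates in it. The tables count from 1, so row [i] of [y] stands for the basis vector
    numbered [i.+3]. *)
Lemma br6_isomorphic (x1 x2 : 'rV[R]_6) (y : 'M[R]_(4, 6)) (T1 T2 : 'M[R]_4)
    (a b : nat -> 'rV[R]_6) :
  br x1 x2 = 0 -> (forall i j, br (row i y) (row j y) = 0) ->
  (forall i, br x1 (row i y) = row i T1 *m y) ->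
  (forall i, br x2 (row i y) = row i T2 *m y) ->
  row_free (col_mx (col_mx x1 x2) y) ->
  (forall i : 'I_4, a i.+3 = row_mx (0 : 'rV_2) (row i T1)) ->
  (forall i : 'I_4, b i.+3 = row_mx (0 : 'rV_2) (row i T2)) ->
  lie_isomorphic br (br6 a b).
Proof.
move=> x12 yy x1y x2y free6 aE bE.
pose B : 'M[R]_6 := col_mx (col_mx x1 x2) y.
have Bu : B \in unitmx by rewrite -row_free_unit.
have mulB (u : 'rV[R]_4) : (row_mx (0 : 'rV_2) u : 'rV_6) *m B = u *m y.
  have := mul_row_col (0 : 'rV_(1 + 1)) u (col_mx x1 x2) y.
  by rewrite mul0mx add0r.
pose k1 : 'I_6 := lshift 4 (@lshift 1 1 ord0).
pose k2 : 'I_6 := lshift 4 (@rshift 1 1 ord0).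
pose k3 (k : 'I_4) : 'I_6 := @rshift 2 4 k.
have row1B : row k1 B = x1.
  by rewrite [LHS](@rowKu _ 2 4) (@rowKu _ 1 1) row_id.
have row2B : row k2 B = x2.
  by rewrite [LHS](@rowKu _ 2 4) (@rowKd _ 1 1) row_id.
have rowyB k : row (k3 k) B = row k y by exact: (@rowKd _ 2 4).
have brB (i j : 'I_6) : br (row i B) (row j B) = sc6 a b i j *m B.
  have ordP (k : 'I_6) : [\/ k = k1, k = k2 | exists k', k = k3 k'].
    case: (@split_ordP 2 4 k) => k' ->; last by constructor 3; exists k'.
    case: (@split_ordP 1 1 k') => l ->; rewrite [l]ord1; first by constructor 1.
    by constructor 2.
  case: (ordP i) => [->|->|[k ->]]; case: (ordP j) => [->|->|[l ->]];
    rewrite ?row1B ?row2B ?rowyB /sc6 /=.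
  all: try by rewrite ?mul0mx ?(brxx lie) ?x12 // (br_anti lie) x12 oppr0.
  - by rewrite x1y [a _]aE mulB.
  - by rewrite x2y [b _]bE mulB.
  - by rewrite (br_anti lie) x1y [a _]aE mulNmx mulB.
  - by rewrite (br_anti lie) x2y [b _]bE mulNmx mulB.
have br6B u v : br (u *m B) (v *m B) = br6 a b u v *m B.
  rewrite (mulmx_sum_row v) (br_sumr lie) /br6 mulmx_suml.
  under [RHS]eq_bigr do rewrite mulmx_suml.
  rewrite exchange_big /=; apply: eq_bigr => j _.
  rewrite (br_anti lie) mulmx_sum_row (br_sumr lie) -sumrN scaler_sumr.
  apply: eq_bigr => i _.
  by rewrite -scalerN -(br_anti lie) scalerA brB -scalemxAl mulrC.
exists (fun u => u *m invmx B); split=> [c u v||u v].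
- by rewrite mulmxDl -scalemxAl.
- by exists (mulmx^~ B) => u; rewrite ?mulmxKV ?mulmxK.
by rewrite -[in LHS](mulmxKV Bu u) -[in LHS](mulmxKV Bu v) br6B mulmxK.
Qed.

Definition mx4 (l : seq (seq R)) : 'M[R]_4 := \matrix_(i, j) nth 0 (nth [::] l i) j.

Let d := derived_series br 1.
Hypothesis abel : derivedS br d = 0.
Variable D : 'M[R]_(4, 6).
Hypotheses (eqD : (D :=: d)%MS) (freeD : row_free D).
Variables (x1 x2 : 'rV[R]_6).
Hypothesis free6 : row_free (col_mx (col_mx x1 x2) D).

(* The rows of [Q] are the basis of functionals dual to [x_3, ..., x_6]. *)
Lemma isomorphic_of_action (Q T1 T2 T1' : 'M[R]_4) (a b : nat -> 'rV[R]_6) :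
  row_free Q -> Q *m (rho br D x1)^T = T1^T *m Q ->
  Q *m (rho br D x2)^T = T2^T *m Q -> T1 *m T1' = 1%:M ->
  (forall i : 'I_4, a i.+3 = row_mx (0 : 'rV_2) (row i T1)) ->
  (forall i : 'I_4, b i.+3 = row_mx (0 : 'rV_2) (row i T2)) ->
  lie_isomorphic br (br6 a b).
Proof.
rewrite row_free_unit => Qu Q1 Q2 /mulmx1_unit[T1u _] aE bE.
pose P := invmx Q^T.
have QTu : Q^T \in unitmx by rewrite unitmx_tr.
have Pu : P \in unitmx by rewrite unitmx_inv.
have rhoQ x T : Q *m (rho br D x)^T = T^T *m Q -> P *m rho br D x = T *m P.
  move/(congr1 trmx); rewrite !trmx_mul !trmxK => e.
  by rewrite -[LHS](mulmxK QTu) -(mulmxA P) e mulmxA mulVmx ?mul1mx.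
have P1 := rhoQ _ _ Q1; have P2 := rhoQ _ _ Q2.
have rho1u : rho br D x1 \in unitmx.
  by rewrite -(mulKmx Pu (rho br D x1)) P1 !unitmx_mul unitmx_inv Pu T1u.
have /submxP[c cE] : (br x1 x2 <= D)%MS by rewrite eqD br_derived.
(* As [x1] acts invertibly on the derived algebra, [[x1, w] = [x1, x2]] has a solution there.
   Replacing [x2] by [x2 - w] makes it commute with [x1] and leaves its action on the derived
   algebra unchanged. *)
pose w := c *m invmx (rho br D x1) *m D.
have wd : (w <= d)%MS by rewrite -eqD submxMl.
pose x2' := x2 - w.
have rho2' : rho br D x2' = rho br D x2.
  rewrite /x2' addrC -scaleN1r (rhoP lie eqD freeD).
  by rewrite (rho_derived lie abel eqD freeD wd) scaler0 add0r.
apply: (@br6_isomorphic x1 x2' (P *m D) T1 T2) => //.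
- rewrite /x2' (brDr lie) -scaleN1r (brZr lie) scaleN1r cE /w.
  by rewrite (br_rho lie eqD) mulmxKV // subrr.
- move=> i j; rewrite !row_mul (br_abelian lie abel) // -eqD submxMl //.
- move=> i; rewrite !row_mul (br_rho lie eqD) -row_mul P1 row_mul -mulmxA.
  by [].
- move=> i; rewrite !row_mul (br_rho lie eqD) rho2' -row_mul P2 row_mul -mulmxA.
  by [].
have -> : col_mx (col_mx x1 x2') (P *m D) =
  block_mx 1%:M (col_mx 0 (- (c *m invmx (rho br D x1)))) 0 P *m
    col_mx (col_mx x1 x2) D.
  rewrite mul_block_col !mul1mx mul0mx add0r; congr col_mx.
  by rewrite mul_col_mx mul0mx add_col_mx addr0 mulNmx.
rewrite row_free_unit unitmx_mul andbC -row_free_unit free6 /=.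
by rewrite unitmxE det_ublock det1 mul1r -unitmxE.
Qed.

Lemma row_mx4 (l : seq (seq R)) (a : nat -> 'rV[R]_6) :
  (forall (i : 'I_4) (j : 'I_6), a i.+3 0 j = nth 0 [:: 0, 0 & nth [::] l i] j) ->
  forall i : 'I_4, a i.+3 = row_mx (0 : 'rV_2) (row i (mx4 l)).
Proof.
move=> aE i; apply/rowP => j; rewrite aE.
case: (@split_ordP 2 4 j) => k ->; last by rewrite (@row_mxEr _ 1 2 4) !mxE.
by rewrite (@row_mxEl _ 1 2 4) mxE; case: k => [[|[|]]].
Qed.

(** * Real normal forms from the two complex functionals *)

Section Realification.
Variables f h : 'rV[R[i]]_4.
(** The functionals dual to [x3], ..., [x6] in this order: the transposed action in the normal forms
    sends those of [x3], [x4] into combinations that may involve those of [x5], [x6], as it does [h]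
    with respect to [f]. *)
Let g := [:: im_mx h; re_mx h; im_mx f; re_mx f].
Let Q : 'M[R]_4 := \matrix_(i < 4) nth 0 g i.

Lemma row_free_realify : indep4 f h -> row_free Q.
Proof.
move/row_free_re_im; congr row_free; apply/row_matrixP => i; rewrite rowK.
case: (@split_ordP 2 2 i) => j ->; rewrite ?(@rowKu _ 2 2) ?(@rowKd _ 2 2);
by case: (@split_ordP 1 1 j) => k ->;
  rewrite ?(@rowKu _ 1 1) ?(@rowKd _ 1 1) row_id ord1.
Qed.

Lemma realify_action (t : 'M[R]_4) (l : seq (seq R)) :
  (forall (i j : 'I_4), (nth 0 g i *m t) 0 j =
     \sum_(k < 4) nth 0 (nth [::] l k) i * nth 0 g k 0 j) ->
  Q *m t = (mx4 l)^T *m Q.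
Proof.
move=> H; apply/row_matrixP => i; rewrite !row_mul rowK [RHS]mulmx_sum_row.
apply/rowP => j; rewrite [LHS]H summxE.
by apply: eq_bigr => k _; rewrite rowK !mxE.
Qed.

(** Reduces a normal form to entrywise identities; [l1'] lists an inverse that certifies the
    invertibility of the action of [x1]. *)
Lemma isomorphic_of_realification (l1 l2 l1' : seq (seq R))
    (a b : nat -> 'rV[R]_6) : indep4 f h ->
  (forall (i j : 'I_4), (nth 0 g i *m (rho br D x1)^T) 0 j =
     \sum_(k < 4) nth 0 (nth [::] l1 k) i * nth 0 g k 0 j) ->
  (forall (i j : 'I_4), (nth 0 g i *m (rho br D x2)^T) 0 j =
     \sum_(k < 4) nth 0 (nth [::] l2 k) i * nth 0 g k 0 j) ->
  mx4 l1 *m mx4 l1' = 1%:M ->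
  (forall (i : 'I_4) (j : 'I_6), a i.+3 0 j = nth 0 [:: 0, 0 & nth [::] l1 i] j) ->
  (forall (i : 'I_4) (j : 'I_6), b i.+3 0 j = nth 0 [:: 0, 0 & nth [::] l2 i] j) ->
  lie_isomorphic br (br6 a b).
Proof.
move=> fh H1 H2 T1u aE bE.
apply: (isomorphic_of_action (row_free_realify fh) (realify_action H1)
          (realify_action H2) T1u); exact: row_mx4.
Qed.

Hypothesis fh : indep4 f h.
Hypothesis f1 : f *m cplxm (rho br D x1)^T = f.
Hypothesis f2 : f *m cplxm (rho br D x2)^T = 'i%C *: f.

Let ref1 : re_mx f *m (rho br D x1)^T = re_mx f.
Proof. by rewrite -re_mx_mul f1. Qed.
Let imf1 : im_mx f *m (rho br D x1)^T = im_mx f.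
Proof. by rewrite -im_mx_mul f1. Qed.
Let ref2 : re_mx f *m (rho br D x2)^T = - im_mx f.
Proof. by rewrite -re_mx_mul f2 re_mxZ /= scale0r sub0r scale1r. Qed.
Let imf2 : im_mx f *m (rho br D x2)^T = re_mx f.
Proof. by rewrite -im_mx_mul f2 im_mxZ /= scale0r add0r scale1r. Qed.

Ltac ord4 := case=> [[|[|[|[|//]]]] ?].
Ltac ord6 := case=> [[|[|[|[|[|[|//]]]]]] ?].

Lemma isomorphic_211 :
  h *m cplxm (rho br D x1)^T = h + f -> h *m cplxm (rho br D x2)^T = 'i%C *: h ->
  lie_isomorphic br (@s6_211 R).
Proof.
move=> h1 h2.
have reh1 : re_mx h *m (rho br D x1)^T = re_mx h + re_mx f.
  by rewrite -re_mx_mul h1 re_mxD.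
have imh1 : im_mx h *m (rho br D x1)^T = im_mx h + im_mx f.
  by rewrite -im_mx_mul h1 im_mxD.
have reh2 : re_mx h *m (rho br D x2)^T = - im_mx h.
  by rewrite -re_mx_mul h2 re_mxZ /= scale0r sub0r scale1r.
have imh2 : im_mx h *m (rho br D x2)^T = re_mx h.
  by rewrite -im_mx_mul h2 im_mxZ /= scale0r add0r scale1r.
apply: (isomorphic_of_realification
  (l1 := [:: [:: 1; 0; 0; 0]; [:: 0; 1; 0; 0]; [:: 1; 0; 1; 0]; [:: 0; 1; 0; 1]])
  (l2 := [:: [:: 0; -1; 0; 0]; [:: 1; 0; 0; 0]; [:: 0; 0; 0; -1]; [:: 0; 0; 1; 0]])
  (l1' := [:: [:: 1; 0; 0; 0]; [:: 0; 1; 0; 0]; [:: -1; 0; 1; 0]; [:: 0; -1; 0; 1]])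
  fh).
- ord4; move=> ?; rewrite !big_ord_recl big_ord0 /= ?reh1 ?imh1 ?ref1 ?imf1 ?mxE; ring.
- ord4; move=> ?; rewrite !big_ord_recl big_ord0 /= ?reh2 ?imh2 ?ref2 ?imf2 ?mxE; ring.
- apply/matrixP; ord4; ord4; rewrite !mxE !big_ord_recl big_ord0 !mxE /=; ring.
- ord4; ord6; rewrite /= ?mxE -?val_eqE /= ?inordK //=; ring.
- ord4; ord6; rewrite /= ?mxE -?val_eqE /= ?inordK //=; ring.
Qed.

(** Half of [f - conjm f] has real part zero and imaginary part [im_mx f]: it produces the
    additional [x3] in [[x2, x5]]. *)
Lemma isomorphic_225 (nu theta : R) :
  h *m cplxm (rho br D x1)^T = h + (nu +i* theta) *: f ->
  h *m cplxm (rho br D x2)^T = 'i%C *: h + (2^-1)%:C *: (f - conjm f) ->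
  lie_isomorphic br (s6_225 nu theta).
Proof.
move=> h1 h2.
have reh1 : re_mx h *m (rho br D x1)^T = re_mx h + (nu *: re_mx f - theta *: im_mx f).
  by rewrite -re_mx_mul h1 re_mxD re_mxZ.
have imh1 : im_mx h *m (rho br D x1)^T = im_mx h + (nu *: im_mx f + theta *: re_mx f).
  by rewrite -im_mx_mul h1 im_mxD im_mxZ.
have [re_f im_f] : re_mx (f - conjm f) = 0 /\ im_mx (f - conjm f) = 2 *: im_mx f.
  by split; apply/rowP => j; rewrite !mxE; case: (f 0 j) => u v /=; ring.
have reh2 : re_mx h *m (rho br D x2)^T = - im_mx h.
  rewrite -re_mx_mul h2 re_mxD !re_mxZ /= re_f im_f.
  by rewrite !scale0r scale1r scaler0 !subr0 sub0r addr0.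
have imh2 : im_mx h *m (rho br D x2)^T = re_mx h + im_mx f.
  rewrite -im_mx_mul h2 im_mxD !im_mxZ /= re_f im_f !scale0r scale1r add0r addr0 scalerA.
  by rewrite mulVf ?scale1r ?pnatr_eq0.
apply: (isomorphic_of_realification
  (l1 := [:: [:: 1; 0; 0; 0]; [:: 0; 1; 0; 0];
             [:: nu; - theta; 1; 0]; [:: theta; nu; 0; 1]])
  (l2 := [:: [:: 0; -1; 0; 0]; [:: 1; 0; 0; 0]; [:: 1; 0; 0; -1]; [:: 0; 0; 1; 0]])
  (l1' := [:: [:: 1; 0; 0; 0]; [:: 0; 1; 0; 0];
              [:: - nu; theta; 1; 0]; [:: - theta; - nu; 0; 1]])
  fh).
- ord4; move=> ?; rewrite !big_ord_recl big_ord0 /= ?reh1 ?imh1 ?ref1 ?imf1 ?mxE; ring.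
- ord4; move=> ?; rewrite !big_ord_recl big_ord0 /= ?reh2 ?imh2 ?ref2 ?imf2 ?mxE; ring.
- apply/matrixP; ord4; ord4; rewrite !mxE !big_ord_recl big_ord0 !mxE /=; ring.
- ord4; ord6; rewrite /= ?mxE -?val_eqE /= ?inordK //=; ring.
- ord4; ord6; rewrite /= ?mxE -?val_eqE /= ?inordK //=; ring.
Qed.

Lemma isomorphic_228 (lambda mu eta zeta : R) :
  h *m cplxm (rho br D x1)^T = (lambda +i* eta) *: h ->
  h *m cplxm (rho br D x2)^T = (mu +i* zeta) *: h ->
  lambda * zeta - eta * mu != 0 ->
  lie_isomorphic br (s6_228 lambda mu eta zeta).
Proof.
move=> h1 h2 det.
have reh1 : re_mx h *m (rho br D x1)^T = lambda *: re_mx h - eta *: im_mx h.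
  by rewrite -re_mx_mul h1 re_mxZ.
have imh1 : im_mx h *m (rho br D x1)^T = lambda *: im_mx h + eta *: re_mx h.
  by rewrite -im_mx_mul h1 im_mxZ.
have reh2 : re_mx h *m (rho br D x2)^T = mu *: re_mx h - zeta *: im_mx h.
  by rewrite -re_mx_mul h2 re_mxZ.
have imh2 : im_mx h *m (rho br D x2)^T = mu *: im_mx h + zeta *: re_mx h.
  by rewrite -im_mx_mul h2 im_mxZ.
have N0 : lambda ^+ 2 + eta ^+ 2 != 0.
  apply: contraNneq det => /eqP; rewrite paddr_eq0 ?sqr_ge0 // !sqrf_eq0.
  by move=> /andP[/eqP-> /eqP->]; rewrite !mul0r subr0.
(* [p - i q] is the inverse of [lambda + i eta]. *)
pose p := lambda / (lambda ^+ 2 + eta ^+ 2).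
pose q := eta / (lambda ^+ 2 + eta ^+ 2).
apply: (isomorphic_of_realification
  (l1 := [:: [:: lambda; - eta; 0; 0]; [:: eta; lambda; 0; 0];
             [:: 0; 0; 1; 0]; [:: 0; 0; 0; 1]])
  (l2 := [:: [:: mu; - zeta; 0; 0]; [:: zeta; mu; 0; 0];
             [:: 0; 0; 0; -1]; [:: 0; 0; 1; 0]])
  (l1' := [:: [:: p; q; 0; 0]; [:: - q; p; 0; 0];
              [:: 0; 0; 1; 0]; [:: 0; 0; 0; 1]])
  fh).
- ord4; move=> ?; rewrite !big_ord_recl big_ord0 /= ?reh1 ?imh1 ?ref1 ?imf1 ?mxE; ring.
- ord4; move=> ?; rewrite !big_ord_recl big_ord0 /= ?reh2 ?imh2 ?ref2 ?imf2 ?mxE; ring.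
- apply/matrixP; ord4; ord4; rewrite !mxE !big_ord_recl big_ord0 !mxE /= /p /q;
    field; by rewrite ?N0.
- ord4; ord6; rewrite /= ?mxE -?val_eqE /= ?inordK //=; ring.
- ord4; ord6; rewrite /= ?mxE -?val_eqE /= ?inordK //=; ring.
Qed.

End Realification.
End NormalForms.

(** * Normalization of signs and the case distinction *)

Section Classification.
Local Open Scope complex_scope.
Variables (R : realType) (br : 'rV[R]_6 -> 'rV[R]_6 -> 'rV[R]_6).
Hypothesis lie : is_lie_bracket br.
Let d := derived_series br 1.
Hypothesis abel : derivedS br d = 0.
Variable D : 'M[R]_(4, 6).
Hypotheses (eqD : (D :=: d)%MS) (freeD : row_free D).

Lemma rho_opp x : rho br D (- x) = - rho br D x.
Proof.
have := rhoP lie eqD freeD (-1) x 0.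
by rewrite (rho_derived lie abel eqD freeD (sub0mx _ _)) !addr0 !scaleN1r.
Qed.

(** Conjugation together with [x2 := - x2] turns an eigenvalue [c] of [x2] into [- conjc c]: this
    fixes [i] and changes the sign of the real part. *)
Lemma conj_action_opp (f : 'rV[R[i]]_4) x :
  conjm f *m cplxm (rho br D (- x))^T = - conjm (f *m cplxm (rho br D x)^T).
Proof.
by rewrite conjmM rho_opp /cplxm linearN /= map_mxN mulmxN.
Qed.

Lemma row_free_opp (x1 x2 : 'rV[R]_6) :
  row_free (col_mx (col_mx x1 x2) D) -> row_free (col_mx (col_mx x1 (- x2)) D).
Proof.
have -> : col_mx (col_mx x1 (- x2)) D =
    block_mx (block_mx 1%:M 0 0 (- 1)%:M) 0 0 1%:M *m col_mx (col_mx x1 x2) D.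
  rewrite !mul_block_col !mul1mx !mul0mx !add0r !addr0.
  by rewrite mul_scalar_mx scaleN1r.
rewrite !row_free_unit unitmx_mul andbC => -> /=.
by rewrite unitmxE !det_ublock !det1 det_scalar1 mul1r mulr1 unitrN unitr1.
Qed.

Section Action.
Variables (x1 x2 : 'rV[R]_6) (f h : 'rV[R[i]]_4).
Hypothesis free6 : row_free (col_mx (col_mx x1 x2) D).
Hypothesis fh : indep4 f h.
Hypothesis f1 : f *m cplxm (rho br D x1)^T = f.
Hypothesis f2 : f *m cplxm (rho br D x2)^T = 'i%C *: f.

Let cf1 : conjm f *m cplxm (rho br D x1)^T = conjm f.
Proof. by rewrite -conjmM f1. Qed.
Let cf2 : conjm f *m cplxm (rho br D (- x2))^T = 'i%C *: conjm f.
Proof.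
rewrite conj_action_opp f2 conjmZ -scaleNr; congr (_ *: _).
by apply/eqP; rewrite eq_complex /= oppr0 opprK !eqxx.
Qed.

Lemma diagonal_case (b1 b2 : R[i]) :
  h *m cplxm (rho br D x1)^T = b1 *: h -> h *m cplxm (rho br D x2)^T = b2 *: h ->
  complex.Re b1 * complex.Im b2 - complex.Im b1 * complex.Re b2 != 0 ->
  exists lambda mu eta zeta : R,
    [/\ lambda * zeta - mu * eta > 0, 0 <= mu &
        lie_isomorphic br (s6_228 lambda mu eta zeta)].
Proof.
move: h fh b1 b2.
(* Conjugating [h] alone negates the determinant, which may thus be taken positive. *)
suff pos h' (b1 b2 : R[i]) : indep4 f h' ->
    h' *m cplxm (rho br D x1)^T = b1 *: h' -> h' *m cplxm (rho br D x2)^T = b2 *: h' ->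
    0 < complex.Re b1 * complex.Im b2 - complex.Im b1 * complex.Re b2 ->
    exists lambda mu eta zeta : R,
      [/\ lambda * zeta - mu * eta > 0, 0 <= mu &
        lie_isomorphic br (s6_228 lambda mu eta zeta)].
  move=> h' fh' b1 b2 h1 h2; rewrite neq_lt => /orP[det_lt0|];
    last exact: (pos h' b1 b2 fh' h1 h2).
  apply: (pos (conjm h') (conjc b1) (conjc b2)); first exact: indep4_conjl.
  - by rewrite -conjmM h1 conjmZ.
  - by rewrite -conjmM h2 conjmZ.
  move: det_lt0; case: (b1) (b2) => l e [m z] /=; lra.
case: b1 b2 => l e [m z] /= fh' h1 h2 det_gt0.
have [m_ge0|m_lt0] := leP 0 m.
  exists l, m, e, z; split=> //; first by rewrite (mulrC m).
  apply: (isomorphic_228 lie abel eqD freeD free6 fh' f1 f2 h1 h2).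
  by rewrite gt_eqF.
(* Conjugating both eigenvectors and negating [x2] changes the signs of [m] and [e] and keeps the
   determinant. *)
exists l, (- m), (- e), z; split; [lra|lra|].
apply: (isomorphic_228 lie abel eqD freeD (row_free_opp free6) (indep4_conj fh') cf1 cf2).
- by rewrite -conjmM h1 conjmZ.
- rewrite conj_action_opp h2 conjmZ -scaleNr; congr (_ *: _).
  by apply/eqP; rewrite eq_complex /= opprK !eqxx.
by rewrite mulrNN gt_eqF.
Qed.

Lemma jordan_case (z : R[i]) :
  h *m cplxm (rho br D x1)^T = h + z *: f ->
  h *m cplxm (rho br D x2)^T = 'i%C *: h + (2^-1)%:C *: (f - conjm f) ->
  exists nu theta : R, 0 <= nu /\ lie_isomorphic br (s6_225 nu theta).
Proof.
case: z => nu theta h1 h2.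
have [nu_ge0|nu_lt0] := leP 0 nu.
  exists nu, theta; split=> //.
  exact: (isomorphic_225 lie abel eqD freeD free6 fh f1 f2 h1 h2).
exists (- nu), theta; split; first lra.
(* The eigenvectors become [- conjm f] and [conjm h]: the factor -1 restores the term in
   [f - conjm f], and [z] becomes [- nu + i theta]. *)
have N1 : (-1 : R[i]) != 0 by rewrite oppr_eq0 oner_eq0.
apply: (isomorphic_225 lie abel eqD freeD (row_free_opp free6)
          (indep4_scale N1 (indep4_conj fh))).
- by rewrite -scalemxAl cf1.
- by rewrite -scalemxAl cf2 !scalerA mulrC.
- rewrite -conjmM h1 conjmD conjmZ scalerA; congr (_ + _ *: _).
  by apply/eqP; rewrite eq_complex /=; apply/andP; split; apply/eqP; ring.
- rewrite conj_action_opp h2; apply/rowP => j; rewrite !mxE.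
  case: (h 0 j) (f 0 j) => p q [u v]; apply/eqP; rewrite eq_complex /=.
  by apply/andP; split; apply/eqP; ring.
Qed.

End Action.

(** If [a1] and [a2] vanish, [h] is an eigenvector with determinant 1. If only [a2] does, rescaling
    [f] by [a1] gives [s6_211]. Otherwise [f] is rescaled by [2 a2] and [h] is shifted along its
    conjugate to reach [s6_225]. *)
Lemma defective_case (x1 x2 : 'rV[R]_6) (f h : 'rV[R[i]]_4) (a1 a2 : R[i]) :
  row_free (col_mx (col_mx x1 x2) D) -> indep4 f h ->
  f *m cplxm (rho br D x1)^T = f -> f *m cplxm (rho br D x2)^T = 'i%C *: f ->
  h *m cplxm (rho br D x1)^T = h + a1 *: f ->
  h *m cplxm (rho br D x2)^T = 'i%C *: h + a2 *: f ->
  [\/ lie_isomorphic br (@s6_211 R),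
      exists nu theta : R, 0 <= nu /\ lie_isomorphic br (s6_225 nu theta) |
      exists lambda mu eta zeta : R,
        [/\ lambda * zeta - mu * eta > 0, 0 <= mu &
            lie_isomorphic br (s6_228 lambda mu eta zeta)]].
Proof.
move=> free6 fh f1 f2 h1 h2; have [a2_0|a2_neq0] := eqVneq a2 0.
  rewrite a2_0 scale0r addr0 in h2.
  have [a1_0|a1_neq0] := eqVneq a1 0.
    rewrite a1_0 scale0r addr0 -[RHS]scale1r in h1.
    constructor 3; apply: (diagonal_case free6 fh f1 f2 h1 h2).
    by rewrite /= mulr0 subr0 mulr1 oner_eq0.
  constructor 1.
  apply: (isomorphic_211 lie abel eqD freeD free6 (indep4_scale a1_neq0 fh)) => //.
    by rewrite -scalemxAl f1.
  by rewrite -scalemxAl f2 !scalerA mulrC.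
constructor 2.
have aa_neq0 : 2%:R * a2 != 0 by rewrite mulf_neq0 // pnatr_eq0.
have a1fE : a1 *: f = (a1 / (2%:R * a2)) *: ((2%:R * a2) *: f).
  by rewrite scalerA divfK.
have a2fE : a2 *: f = (2^-1)%:C *: ((2%:R * a2) *: f).
  rewrite scalerA mulrA (_ : _ * 2%:R = 1) ?mul1r //.
  by apply/eqP; rewrite eq_complex /=; apply/andP; split; apply/eqP; field.
have F1 : ((2%:R * a2) *: f) *m cplxm (rho br D x1)^T = (2%:R * a2) *: f.
  by rewrite -scalemxAl f1.
have F2 : ((2%:R * a2) *: f) *m cplxm (rho br D x2)^T = 'i%C *: ((2%:R * a2) *: f).
  by rewrite -scalemxAl f2 !scalerA mulrC.
have Fh := indep4_scale aa_neq0 fh.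
move: {aa_neq0} (a1 / _) a1fE => z a1fE; rewrite {}a1fE in h1; rewrite {}a2fE in h2.
move: (_ *: f) F1 F2 Fh h1 h2 => F F1 F2 Fh h1 h2.
(* The shift by [- 'i / 4] makes the component of [h tau(x2)] along
   [conjm F] equal to [- 1 / 2]. *)
pose c : R[i] := 0 +i* (- 4^-1).
apply: (jordan_case (z := z) free6 (indep4_shift (x := c) Fh) F1 F2).
  (* [x1] fixes [conjm F], so the shift keeps the coefficient [z]. *)
  by rewrite mulmxDl -scalemxAl -conjmM F1 h1 addrAC.
rewrite mulmxDl -scalemxAl -conjmM F2 h2; apply/rowP => j; rewrite !mxE.
case: (h 0 j) (F 0 j) => p q [u v]; apply/eqP; rewrite eq_complex /=.
by apply/andP; split; apply/eqP; field.
Qed.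


End Classification.

(** Keeping the number [m] of rows of [D] a variable allows substituting [n = 6] and [m = 4] before
    the normal forms are applied. *)
Lemma classification_of_basis (R : realType) (n m : nat)
  (br : 'rV[R]_n -> 'rV[R]_n -> 'rV[R]_n) (D : 'M[R]_(m, n)) :
  is_lie_bracket br -> derivedS br (derived_series br 1) = 0 ->
  (D :=: derived_series br 1)%MS -> row_free D ->
  (forall F : 'cV[R]_n, derived_series br 1 *m F != 0 ->
    \rank (coadj_matrix br F) = (n - 2)%N) ->
  (6 <= n)%N -> (3 <= m)%N ->
  n = 6%N /\
  [\/ lie_isomorphic br (@s6_211 R),
      exists nu theta : R, 0 <= nu /\ lie_isomorphic br (s6_225 nu theta) |
      exists lambda mu eta zeta : R,
        [/\ lambda * zeta - mu * eta > 0, 0 <= mu &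
            lie_isomorphic br (s6_228 lambda mu eta zeta)]].
Proof.
move=> lie abel eqD freeD MD n_ge6 m_ge3.
have [n6 m4 [x1 [x2 [f [h [b1 [b2 [a1 [a2 []]]]]]]]]] :=
  joint_eigenbasis lie abel eqD freeD MD n_ge6 m_ge3.
move: n6 m4 => {n_ge6 m_ge3 MD} n6 m4; subst n m.
move=> free6 fh [f1 f2] [h1 h2] cases; split=> //.
case: cases => [[a1_0 a2_0 det]|[b1_1 b2_i]].
  constructor 3; rewrite a1_0 scale0r addr0 in h1; rewrite a2_0 scale0r addr0 in h2.
  exact: (diagonal_case lie abel eqD freeD free6 fh f1 f2 h1 h2 det).
rewrite b1_1 scale1r in h1; rewrite b2_i in h2.
exact: (defective_case lie abel eqD freeD free6 fh f1 f2 h1 h2).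
Qed.

Unset Implicit Arguments.

Theorem theorem3p1 (R : realType) (n : nat)
  (br : 'rV[R]_n -> 'rV[R]_n -> 'rV[R]_n) :
  is_lie_bracket br ->
  step_solvable br 1 ->
  MD_algebra br (n - 2) ->
  (6 <= n)%N ->
  (3 <= \rank (derived_series br 1))%N ->
  n = 6%N /\
  [\/ lie_isomorphic br (@s6_211 R),
      exists nu theta : R, 0 <= nu /\ lie_isomorphic br (s6_225 nu theta),
      exists lambda mu zeta : R,
        [/\ lambda != 0, 0 <= mu, 0 < zeta <= 1,
            (zeta = 1 -> `|lambda| <= 1) &
            lie_isomorphic br (s6_226 lambda mu zeta)] |
      exists lambda mu eta zeta : R,
        [/\ lambda * zeta - mu * eta > 0, 0 <= mu &
            lie_isomorphic br (s6_228 lambda mu eta zeta)]].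
Proof.
move=> lie [abel _] [_ MD] n_ge6 rk_ge3.
have [n6 H] := classification_of_basis lie abel (eq_row_base _) (row_base_free _)
  MD n_ge6 rk_ge3.
split=> //; case: H => [?|?|?]; [exact: Or41|exact: Or42|].
exact: Or44.
Qed.
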